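(* Let $d\ge 0$ be an integer and let $G$ be a $d$-regular graph that contains no $4$-cycle. Then $\varphi(G)\geq\left\lfloor\frac{d+3}{2}\right\rfloor$. Moreover, if $G$ has a triangle, then $\varphi(G)\geq\left\lfloor\frac{d+4}{2}\right\rfloor$. These lower bounds are sharp for the Petersen graph: the Petersen graph is $3$-regular, contains no $4$-cycle, and its b-chromatic number is $3=\left\lfloor\frac{3+3}{2}\right\rfloor=\left\lfloor\frac{3+4}{2}\right\rfloor$.
   Context: All graphs are finite and simple (undirected, loopless, without multiple edges), with nonempty vertex set. ''Contains no $4$-cycle'' means that $G$ has no subgraph (not necessarily induced) isomorphic to the cycle $C_4$ of length $4$. A b-coloring of a graph $G$ by $k$ colors is a proper vertex coloring with $k$ colors in which each of the $k$ color classes contains a vertex that is adjacent to at least one vertex in each of the other $k-1$ color classes. The b-chromatic number $\varphi(G)$ is the largest integer $k$ such that $G$ admits a b-coloring by $k$ colors. *)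

(* Defs.v *)
From mathcomp Require Import all_boot.

Set Implicit Arguments.
Unset Strict Implicit.
Unset Printing Implicit Defensive.

(* The vertex set may be empty; nonemptiness is stated where it is assumed. *)
Record sgraph := SGraph {
  svertex :> finType;
  sedge : rel svertex;
  sedge_sym : symmetric sedge;
  sedge_irr : irreflexive sedge }.

Notation "x -- y" := (sedge x y) (at level 30).

Definition regular (d : nat) (G : sgraph) :=
  forall v : G, #|[set w : G | v -- w]| = d.

(* Not necessarily induced. *)
Definition contains_subgraph (H G : sgraph) :=
  exists2 f : H -> G, injective f & forall x y : H, x -- y -> f x -- f y.

(* ordS is the successor modulo n. The guard i != j only matters for n = 1. *)
Definition cycle_rel (n : nat) : rel 'I_n :=
  [rel i j | (i != j) && ((j == ordS i) || (i == ordS j))].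

Lemma cycle_rel_sym n : symmetric (@cycle_rel n).
Proof. by move=> i j; rewrite /cycle_rel /= eq_sym orbC. Qed.

Lemma cycle_rel_irr n : irreflexive (@cycle_rel n).
Proof. by move=> i; rewrite /cycle_rel /= eqxx. Qed.

Definition cycle_graph (n : nat) : sgraph :=
  SGraph (@cycle_rel_sym n) (@cycle_rel_irr n).

Definition proper_coloring (G : sgraph) (k : nat) (c : {ffun G -> 'I_k}) : bool :=
  [forall u : G, forall v : G, (u -- v) ==> (c u != c v)].

Definition b_vertex (G : sgraph) (k : nat) (c : {ffun G -> 'I_k}) (v : G) : bool :=
  [forall j : 'I_k, (j != c v) ==> [exists w : G, (v -- w) && (c w == j)]].

Definition b_coloring (G : sgraph) (k : nat) (c : {ffun G -> 'I_k}) : bool :=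
  proper_coloring c &&
  [forall i : 'I_k, exists v : G, (c v == i) && b_vertex c v].

Definition b_colorable (G : sgraph) (k : nat) : bool :=
  [exists c : {ffun G -> 'I_k}, b_coloring c].

Lemma b_colorable_leq (G : sgraph) (k : nat) : b_colorable G k -> k <= #|G|.
Proof.
case/existsP=> c /andP[_ /forallP cb]; rewrite -[k in k <= _]card_ord.
apply: leq_trans (leq_image_card c G); apply/subset_leq_card/subsetP=> i _.
have /existsP[v /andP[/eqP <- _]] := cb i; exact: image_f.
Qed.

(* By b_colorable_leq, the bound k <= #|G| excludes no b-coloring. *)
Definition b_chromatic (G : sgraph) : nat :=
  \max_(k < #|G|.+1 | b_colorable G k) k.

Lemma b_chromatic_max (G : sgraph) (k : nat) :
  b_colorable G k -> k <= b_chromatic G.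
Proof.
move=> ck; have kG : k < #|G|.+1 by rewrite ltnS b_colorable_leq.
exact: (leq_bigmax_cond (Ordinal kG)).
Qed.

Lemma b_chromatic_attained (G : sgraph) (k : nat) :
  b_colorable G k -> b_colorable G (b_chromatic G).
Proof.
move=> ck; have kG : k < #|G|.+1 by rewrite ltnS b_colorable_leq.
by rewrite /b_chromatic (bigmax_eq_arg (Ordinal kG)) //; case: arg_maxnP.
Qed.

(* The Petersen graph as the Kneser graph K(5, 2). *)
Definition petersen_vertex : finType := {A : {set 'I_5} | #|A| == 2}.

Definition petersen_rel : rel petersen_vertex :=
  fun A B => [disjoint val A & val B].

Lemma petersen_rel_sym : symmetric petersen_rel.
Proof. by move=> A B; rewrite /petersen_rel /= disjoint_sym. Qed.

Lemma petersen_rel_irr : irreflexive petersen_rel.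
Proof.
case=> A cA; rewrite /petersen_rel /=; apply/negP; rewrite -setI_eq0 setIid => /eqP A0.
by rewrite A0 cards0 in cA.
Qed.

Definition petersen : sgraph := SGraph petersen_rel_sym petersen_rel_irr.

(* Main.v *)
(* We look for a proper (d+1)-colouring in which many colours have a vertex u
   that sees all the others, i.e. N[u] is rainbow; b_chromatic_b_vertices turns
   m such colours into phi(G) >= m. Give N[v] distinct colours and treat some
   neighbours u of v in turn: the vertices of N(u) \ N[v] must receive the
   colours missing in N[u] :&: N[v] bijectively. As there is no C4, after t steps
   each vertex excludes at most t colours and each colour excludes at most t
   vertices, so this is possible while 2t <= |N(u) \ N[v]|. Without triangles
   the latter is d - 1. If v lies on a triangle v a b it is at least d - 2, but
   b does not count for a, so treating a last gains one step. *)

Require Import Defs.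
From mathcomp Require Import all_boot fingroup perm.
From mathcomp Require Import zify.

Set Implicit Arguments.
Unset Strict Implicit.
Unset Printing Implicit Defensive.

(** * Counting and injections in finite sets *)

Lemma subset_of_card (T : finType) (A B : {set T}) m :
  A \subset B -> #|A| <= m <= #|B| ->
  exists P : {set T}, [/\ A \subset P, P \subset B & #|P| = m].
Proof.
move=> sAB; elim: m => [|m IHm] /andP[Am mB].
  by exists A; split=> //; apply/eqP; rewrite -leqn0.
move: Am; rewrite leq_eqVlt => /orP[/eqP cA|Am]; first by exists A.
have [|P [sAP sPB cP]] := IHm; first by rewrite -ltnS Am ltnW.
have /subsetPn[x Bx Px] : ~~ (B \subset P).
  by apply: contraTN mB => /subset_leq_card; rewrite cP -ltnNge.
exists (x |: P); split; last by rewrite cardsU1 Px cP.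
  by apply: subset_trans sAP (subsetUr _ _).
by rewrite subUset sub1set Bx.
Qed.

Lemma leq_card_bigcup (I T : finType) (A : {set I}) (F : I -> {set T}) :
  {in A, forall i, #|F i| <= 1} -> #|\bigcup_(i in A) F i| <= #|A|.
Proof.
move=> F1; rewrite -[leqRHS]sum1_card; elim/big_rec2: _ => [|i n B Ai IH].
  by rewrite cards0.
by apply: leq_trans (leq_card_setU _ _) _; apply: leq_add (F1 i Ai) IH.
Qed.

Lemma leq_injection (A B : finType) (b0 : B) (U : {set A}) (C : {set B}) :
  #|U| <= #|C| ->
  exists2 f : A -> B, {in U &, injective f} & {in U, forall x, f x \in C}.
Proof.
move=> leUC; pose i x := index x (enum U).
have iC x : x \in U -> i x < size (enum C).
  by move=> Ux; rewrite -cardE (leq_trans _ leUC) // cardE index_mem mem_enum.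
exists (fun x => nth b0 (enum C) (i x)) => [x y Ux Uy /eqP|x Ux].
  rewrite nth_uniq ?enum_uniq ?iC // => /eqP/(congr1 (nth x (enum U))).
  by rewrite !nth_index ?mem_enum.
by rewrite -mem_enum mem_nth ?iC.
Qed.

(* As long as some x is sent to a bad value, the two bounds leave an x' such
   that exchanging the values at x and x' makes both of them good. *)
Lemma avoiding_injection (A B : finType) (b0 : B) (U : {set A}) (C : {set B})
    (bad : A -> B -> bool) t :
  #|U| <= #|C| -> t.*2 <= #|U| ->
  {in U, forall x, #|[set j in C | bad x j]| <= t} ->
  {in C, forall j, #|[set x in U | bad x j]| <= t} ->
  exists2 f : A -> B, {in U &, injective f}
    & {in U, forall x, (f x \in C) && ~~ bad x (f x)}.
Proof.
move=> leUC leU badU badC.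
have [f0 f0I f0C] := leq_injection b0 leUC.
have [n] := ubnP #|[set x in U | bad x (f0 x)]|.
elim: n f0 f0I f0C => // n IHn f fI fC; rewrite ltnS => le_n.
have [noBad|[x]] := set_0Vmem [set x in U | bad x (f x)].
  exists f => // x Ux; rewrite fC //=; apply: contraT; rewrite negbK => bx.
  by have := in_set0 x; rewrite -noBad inE Ux bx.
rewrite inE => /andP[Ux bx].
pose S1 := [set y in U | bad x (f y)]; pose S2 := [set y in U | bad y (f x)].
have cS1 : #|S1| <= t.
  apply: leq_trans (badU x Ux); rewrite -(card_in_imset (f := f) (D := S1)).
    apply/subset_leq_card/subsetP=> z /imsetP[y + ->].
    by rewrite !inE => /andP[Uy ->]; rewrite fC.
  by move=> y z; rewrite !inE => /andP[Uy _] /andP[Uz _]; apply: fI.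
have cS2 : #|S2| <= t by apply: badC; apply: fC.
(* [x] lies in both [S1] and [S2], so their union has fewer than 2t elements and misses some [y] of
   [U]. *)
have /subsetPn[y Uy] : ~~ (U \subset S1 :|: S2).
  apply/negP=> /subset_leq_card; rewrite cardsU.
  have : 0 < #|S1 :&: S2| by apply/card_gt0P; exists x; rewrite !inE Ux bx.
  by have := subset_leq_card (subsetIl S1 S2); lia.
rewrite !inE Uy /= negb_or => /andP[bxy byx].
have sU z : z \in U -> tperm x y z \in U by case: tpermP => // ->.
apply: (IHn (f \o tperm x y)) => [u w Uu Uw e|z Uz|].
- by apply: (@perm_inj _ (tperm x y)); apply: fI e; apply: sU.
- by apply: fC; apply: sU.
- apply: leq_trans le_n; apply: proper_card; apply/properP; split.
    apply/subsetP=> z; rewrite !inE /= => /andP[Uz].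
    by rewrite Uz; case: tpermP => [->|->|]; rewrite ?(negbTE bxy) ?(negbTE byx).
  by exists x; rewrite !inE ?Ux //= tpermL.
Qed.

(** * Closed neighbourhoods, rainbow sets and 4-cycles *)

Definition nbr (G : sgraph) (x : G) : {set G} := [set w | x -- w].
Definition cnbr (G : sgraph) (x : G) : {set G} := x |: nbr x.
Definition cnbrs (G : sgraph) (Q : {set G}) : {set G} := \bigcup_(u in Q) cnbr u.

(** Only the values on [cnbrs Q] are constrained, so a total [c] encodes a partial colouring;
    [proper_extension] later replaces the other values. *)
Definition rainbow (G : sgraph) (C : Type) (Q : {set G}) (c : G -> C) : Prop :=
  {in Q, forall u, {in cnbr u &, injective c}} /\
  {in cnbrs Q &, forall x y, x -- y -> c x <> c y}.

Definition C4_free (G : sgraph) : Prop :=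
  forall x y a b : G, x != y -> x -- a -> x -- b -> y -- a -> y -- b -> a = b.

Lemma C4_freeP (G : sgraph) :
  ~ contains_subgraph (cycle_graph 4) G <-> C4_free G.
Proof.
split=> [nC4 x y a b xy xa xb ya yb|C4 [f fI fE]].
  have [//|ab] := eqVneq a b; case: nC4.
  pose t := [tuple x; a; y; b]; exists (tnth t : cycle_graph 4 -> G).
    apply/tuple_uniqP => /=; rewrite !inE !negb_or xy ab !andbT /=.
    (* The four remaining pairs are edges, and no vertex is adjacent to itself. *)
    by do ?[apply/andP; split]; apply/eqP=> e; move: xa xb ya yb; subst;
       rewrite ?sedge_irr.
  move=> i j; rewrite !(tnth_nth x) /= /cycle_rel /= -!val_eqE /=.
  by case: i j => [[|[|[|[|]]]]] //= _ [[|[|[|[|]]]]] //= _; rewrite // sedge_sym.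
pose i k (H : k < 4) : cycle_graph 4 := Ordinal H.
have := C4 (f (i 0 isT)) (f (i 2 isT)) (f (i 1 isT)) (f (i 3 isT)).
by rewrite (inj_eq fI) !fE // => /(_ isT isT isT isT isT) /fI.
Qed.

Lemma in_nbr (G : sgraph) (x y : G) : (y \in nbr x) = x -- y.
Proof. by rewrite inE. Qed.

Lemma in_cnbr (G : sgraph) (x y : G) : (y \in cnbr x) = (y == x) || x -- y.
Proof. by rewrite !inE. Qed.

Lemma card_cnbr d (G : sgraph) (x : G) : regular d G -> #|cnbr x| = d.+1.
Proof. by move=> reg; rewrite cardsU1 in_nbr sedge_irr; congr _.+1; apply: reg. Qed.

(** * From partial colourings to b-colorings *)

(** Greedy colouring: at most [d] neighbours leave one of [d.+1] colours free. *)
Lemma proper_extension d (G : sgraph) (D : {set G}) (c : G -> 'I_d.+1) :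
  (forall x : G, #|nbr x| <= d) ->
  {in D &, forall x y, x -- y -> c x <> c y} ->
  exists2 c' : G -> 'I_d.+1,
    {in D, c' =1 c} & forall x y : G, x -- y -> c' x <> c' y.
Proof.
move=> deg; have [n] := ubnP #|~: D|; elim: n D c => // n IHn D c le_n prop.
have [D0|[w]] := set_0Vmem (~: D).
  have DT z : z \in D by rewrite -[D]setCK D0 !inE.
  by exists c => // x y; apply: prop.
rewrite inE => Dw.
have /subsetPn[j _ jN] : ~~ ([set: 'I_d.+1] \subset c @: nbr w).
  apply/negP=> /subset_leq_card; rewrite cardsT card_ord => le_d.
  by have := leq_trans le_d (leq_trans (leq_imset_card _ _) (deg w)); rewrite ltnn.
have jc y : w -- y -> c y <> j.
  by move=> wy cy; rewrite -cy imset_f ?in_nbr in jN.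
have [||c' c'D c'P] := IHn (w |: D) (fun x => if x == w then j else c x).
- rewrite ltnS in le_n; apply: leq_trans le_n; apply: proper_card.
  rewrite properC; apply/properP.
  by split; [apply: subsetUr | exists w; rewrite ?setU11].
- move=> x y; rewrite !inE; case: (eqVneq x w) => [->|_] /=.
    case: (eqVneq y w) => [->|_] /=; first by rewrite sedge_irr.
    by move=> _ _ /jc cy e; apply: cy.
  case: (eqVneq y w) => [->|_] /=; last exact: prop.
  by rewrite sedge_sym => _ _ /jc.
exists c' => // x Dx; rewrite c'D ?inE ?Dx ?orbT //.
by case: eqP => // xw; rewrite xw (negbTE Dw) in Dx.
Qed.

(* A colour class without b-vertex can be eliminated by recolouring each of its
   vertices with a colour missing from the neighbourhood; the b-vertices of the
   other classes remain b-vertices. *)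
Lemma b_chromatic_b_vertices (G : sgraph) k (c : {ffun G -> 'I_k}) (B : {set G}) :
  proper_coloring c -> {in B, forall x, b_vertex c x} -> {in B &, injective c} ->
  #|B| <= b_chromatic G.
Proof.
elim: k c => [|k IHk] c cP cB cI.
  case: (set_0Vmem B) => [->|[x _]]; first by rewrite cards0.
  by case: (c x).
have [cb|] := boolP (b_coloring c).
  apply: leq_trans (b_chromatic_max (k := k.+1) _); last by apply/existsP; exists c.
  by rewrite -(card_in_imset cI) (leq_trans (max_card _)) ?card_ord.
rewrite /b_coloring cP /= => /forallPn[i /existsPn noi].
(* A vertex of colour [i] is no b-vertex, so some other colour is missing around it; the implication
   makes the choice total in [x]. *)
have miss (x : G) : exists j : 'I_k, (c x == i) ==>
    [forall w : G, (x -- w) ==> (c w != lift i j)].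
  case: (eqVneq (c x) i) => [cx|ci]; last first.
    by case: (unliftP i (c x)) => [j _|e]; [exists j | rewrite e eqxx in ci].
  have := noi x; rewrite cx eqxx /= => /forallPn[j]; rewrite negb_imply cx.
  case: (unliftP i j) => [j' ->|->]; last by rewrite eqxx.
  case/andP=> _ /existsPn nj; exists j'; apply/forallP=> w; apply/implyP=> xw.
  by have := nj w; rewrite xw.
have [m mP'] := fin_all_exists miss.
have mP x : c x = i -> forall w, x -- w -> c w <> lift i (m x).
  move=> cx w xw; have := mP' x.
  by rewrite cx eqxx => /forallP/(_ w); rewrite xw => /eqP.
(* [lift i] identifies the [k] remaining colours with those other than [i]: vertices outside class
   [i] keep their colour, those inside take [m]. *)
pose c' := [ffun x => odflt (m x) (unlift i (c x))].
have c'E x : c x <> i -> lift i (c' x) = c x.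
  by rewrite ffunE; case: unliftP.
have c'i x : c x = i -> c' x = m x by rewrite ffunE => ->; rewrite unlift_none.
have cP' x y : x -- y -> c x <> c y.
  by move=> xy; apply/eqP; move/forallP/(_ x)/forallP/(_ y): cP; rewrite xy.
have Bi x : x \in B -> c x <> i.
  by move=> Bx cx; have := noi x; rewrite cx eqxx cB.
apply: (IHk c').
- apply/forallP=> x; apply/forallP=> y; apply/implyP=> xy; apply/eqP=> e.
  (* Class [i] is independent, so recolouring all of it at once creates no conflict. *)
  case: (c x =P i) (c y =P i) => [cx|cx] [cy|cy].
  + by apply: (cP' x y xy); rewrite cx.
  + by apply: (mP x cx y xy); rewrite -c'i // e c'E.
  + by apply: (mP y cy x); rewrite 1?sedge_sym // -c'i // -e c'E.
  + by apply: (cP' x y xy); rewrite -c'E // e c'E.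
- move=> x Bx; apply/forallP=> j; apply/implyP=> jx.
  have /forallP/(_ (lift i j)) := cB x Bx.
  rewrite -(c'E x (Bi x Bx)) (inj_eq lift_inj) jx /= => /existsP[w /andP[xw /eqP cw]].
  apply/existsP; exists w; rewrite xw /=; apply/eqP; apply: (@lift_inj _ i).
  by rewrite c'E cw // => e; have := neq_lift i j; rewrite e eqxx.
- move=> x y Bx By e; apply: cI => //.
  by rewrite -(c'E x (Bi x Bx)) -(c'E y (Bi y By)) e.
Qed.

(** For [u] in [v |: P], the [d.+1] vertices of [cnbr u] take all colours, so [u] is a b-vertex;
    these [u] have distinct colours because they all lie in [cnbr v]. *)
Lemma b_chromatic_rainbow d (G : sgraph) (v : G) (P : {set G}) (c : G -> 'I_d.+1) :
  regular d G -> P \subset nbr v -> rainbow (v |: P) c -> #|P| < b_chromatic G.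
Proof.
move=> reg sPv [cI cP].
have degG (x : G) : #|nbr x| <= d by rewrite -(reg x).
have [c' c'D c'P] := proper_extension degG cP.
have sub u : u \in v |: P -> {subset cnbr u <= cnbrs (v |: P)}.
  by move=> Qu x ux; apply/bigcupP; exists u.
have c'I u : u \in v |: P -> {in cnbr u &, injective c'}.
  move=> Qu x y ux uy; rewrite !c'D ?(sub u) //; exact: (cI u Qu).
have vP : v \notin P.
  by apply/negP=> /(subsetP sPv); rewrite in_nbr sedge_irr.
have -> : #|P|.+1 = #|v |: P| by rewrite cardsU1 vP.
apply: (@b_chromatic_b_vertices _ d.+1 (finfun c')).
- apply/forallP=> x; apply/forallP=> y; apply/implyP=> xy.
  by rewrite !ffunE; apply/eqP; apply: c'P.
- move=> u Qu; apply/forallP=> j; rewrite ffunE; apply/implyP=> ju.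
  have cT : c' @: cnbr u = [set: 'I_d.+1].
    apply/eqP; rewrite eqEcard subsetT cardsT card_ord card_in_imset; last exact: c'I.
    by rewrite (card_cnbr _ reg) leqnn.
  have : j \in c' @: cnbr u by rewrite cT inE.
  case/imsetP=> w; rewrite in_cnbr => /predU1P[-> e|uw ->].
    by rewrite e eqxx in ju.
  by apply/existsP; exists w; rewrite uw ffunE /=.
- move=> x y Qx Qy; rewrite !ffunE; apply: (c'I v); rewrite ?setU11 //.
    by move: x Qx {y Qy}; apply/subsetP; rewrite setUS.
  by move: y Qy {x Qx}; apply/subsetP; rewrite setUS.
Qed.

(** * Construction of rainbow colourings *)

(* The new vertices are those of U := N(u) \ N[v]. Both bad counts are at most
   #|P :\: nbr u|: for w in P, a vertex of U and a vertex of N(w) \ N[v] are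
   never adjacent if w is adjacent to u, and otherwise a vertex of U (resp. of
   N(w)) has at most one neighbour in N(w) (resp. in U), since there is no C4. *)
Lemma rainbow_add d (G : sgraph) (v u : G) (P : {set G}) (c : G -> 'I_d.+1) :
  regular d G -> C4_free G -> P \subset nbr v -> v -- u -> u \notin P ->
  (#|P :\: nbr u|).*2 <= #|nbr u :\: cnbr v| ->
  rainbow (v |: P) c -> exists c' : G -> 'I_d.+1, rainbow (v |: (u |: P)) c'.
Proof.
move=> reg C4 sPv vu uP le_t [cI cP].
have Pv w : w \in P -> v -- w by move/(subsetP sPv); rewrite in_nbr.
set U := nbr u :\: cnbr v; set T := P :\: nbr u.
pose C := ~: (c @: (cnbr u :&: cnbr v)).
have cIv : {in cnbr v &, injective c} by apply: cI; rewrite setU11.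
have UE x : x \in U -> [/\ u -- x, x != v & ~~ (v -- x)].
  by rewrite !inE negb_or => /andP[/andP[-> ->] ->].
(* Both numbers are d + 1 minus the size of [cnbr u :&: cnbr v], on which [c] is injective. *)
have eqUC : #|U| = #|C|.
  have U' : U = cnbr u :\: cnbr v.
    by apply/setP=> x; rewrite !inE; case: (eqVneq x u) => [->|]; rewrite ?vu ?orbT.
  rewrite [RHS]cardsCs setCK card_ord card_in_imset; last first.
    by move=> x y; rewrite !inE => /andP[_ xv] /andP[_ yv]; apply: cIv; rewrite !inE.
  by rewrite U' cardsD (card_cnbr _ reg).
pose bad x j := [exists y in cnbrs (v |: P), (x -- y) && (c y == j)].
(* A conflict over a colour of [C] can only come from some [w] in [P] that is not adjacent to
   [u]. *)
have badE x j : x \in U -> j \in C -> bad x j ->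
    exists w y, [/\ w \in T, w -- y, x -- y & c y = j].
  move=> Ux Cj /exists_inP[y /bigcupP[w Qw wy] /andP[xy /eqP cy]].
  have [ux xv vx] := UE x Ux.
  have yv : y \notin cnbr v.
    rewrite in_cnbr; apply/negP=> /predU1P[e|vy].
      by rewrite e sedge_sym (negbTE vx) in xy.
    (* [u] is the only common neighbour of [x] and [v], and its colour is not in [C]. *)
    have yu : y = u by apply: (C4 x v y u); rewrite // sedge_sym.
    move: Cj; rewrite inE -cy imset_f // yu !inE eqxx /=; exact/orP/or_intror.
  have wP : w \in P.
    by move: Qw wy; case/setU1P=> [->|//]; rewrite (negbTE yv).
  move: wy; rewrite in_cnbr => /predU1P[e|wy].
    by rewrite e in_cnbr Pv ?orbT in yv.
  exists w, y; split=> //; rewrite inE wP andbT in_nbr; apply/negP=> uw.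
  (* Otherwise [u] and [y] share [x] and [w], so [x = w] would be adjacent to [v]. *)
  have := C4 u y x w; rewrite ux uw [y -- x]sedge_sym xy [y -- w]sedge_sym wy.
  have uy : u != y by apply: contraNneq yv => <-; rewrite in_cnbr vu orbT.
  by move=> /(_ uy isT isT isT isT) e; rewrite e Pv in vx.
have [||x Ux|j Cj|f fI fC] := @avoiding_injection G _ (ord0 : 'I_d.+1) U C bad #|T|.
- by rewrite eqUC.
- exact: le_t.
- apply: leq_trans (leq_card_bigcup (A := T) (F := fun w => c @: (nbr w :&: nbr x)) _).
    apply/subset_leq_card/subsetP=> j; rewrite inE => /andP[Cj /(badE x j Ux Cj)].
    case=> w [y [Tw wy xy <-]]; apply/bigcupP; exists w => //.
    by rewrite imset_f // !inE wy xy.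
  move=> w; rewrite inE => /andP[uw wP]; apply: leq_trans (leq_imset_card _ _) _.
  apply/card_le1_eqP=> y z; rewrite !inE => /andP[wy xy] /andP[wz xz].
  apply: (C4 w x) => //; apply/eqP=> e; have [_ _] := UE x Ux.
  by rewrite -e Pv.
- apply: leq_trans (leq_card_bigcup (A := T) (F := fun w =>
      [set x in U | [exists y in nbr w, (x -- y) && (c y == j)]]) _).
    apply/subset_leq_card/subsetP=> x; rewrite inE => /andP[Ux /(badE x j Ux Cj)].
    case=> w [y [Tw wy xy cy]]; apply/bigcupP; exists w => //.
    rewrite inE Ux; apply/exists_inP; exists y; rewrite ?in_nbr //.
    by rewrite xy cy eqxx.
  move=> w; rewrite inE in_nbr => /andP[uw wP]; apply/card_le1_eqP=> x1 x2.
  rewrite [x1 \in _]inE [x2 \in _]inE =>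
    /andP[/UE[ux1 _ _] /exists_inP[y1 wy1 /andP[xy1 /eqP cy1]]].
  case/andP=> /UE[ux2 _ _] /exists_inP[y2 wy2 /andP[xy2 /eqP cy2]].
  rewrite in_nbr in wy1; rewrite in_nbr in wy2.
  (* [c] is injective on [cnbr w], so [w] has only one neighbour of colour [j]. *)
  have e : y1 = y2.
    apply: (cI w); rewrite ?cy1 ?cy2 // ?in_cnbr ?wy1 ?wy2 ?orbT //.
    by rewrite inE wP orbT.
  subst y2; apply: (C4 u y1); rewrite // 1?sedge_sym //.
  by apply: contraNneq uw => ->; rewrite sedge_sym.
exists (fun x => if x \in U then f x else c x).
(* For [w] in [P], a vertex of [U] in [cnbr w] would be, besides [v], a second common neighbour of
   [u] and [w]. Hence the neighbourhoods treated before keep their colours. *)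
have oldU w x : w \in v |: P -> x \in cnbr w -> x \in U = false.
  case/setU1P=> [->|wP] wx; first by rewrite inE wx.
  apply/negP=> /UE[ux xv vx]; move: wx; rewrite in_cnbr => /predU1P[e|wx].
    by rewrite e Pv in vx.
  have uw : u != w by apply: contraNneq uP => ->.
  have := C4 u w x v uw ux; rewrite sedge_sym vu wx sedge_sym Pv // => /(_ isT isT isT) e.
  by rewrite e eqxx in xv.
have newE x : x \in cnbrs (v |: (u |: P)) -> x \in U \/ x \in cnbrs (v |: P).
  have old w : w \in v |: P -> x \in cnbr w -> x \in cnbrs (v |: P).
    by move=> Qw wx; apply/bigcupP; exists w.
  case/bigcupP=> w; rewrite setUCA => /setU1P[->|Qw] wx; last by right; apply: old wx.
  have [xv|xv] := boolP (x \in cnbr v).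
    by right; apply: (old v); rewrite ?setU11.
  left; rewrite inE xv in_nbr; move: wx; rewrite in_cnbr => /predU1P[e|//].
  by rewrite e in_cnbr vu orbT in xv.
have nbad x y : x \in U -> y \in cnbrs (v |: P) -> x -- y -> f x <> c y.
  move=> Ux Qy xy e; have /andP[_ /existsP[]] := fC x Ux.
  by exists y; rewrite Qy xy e eqxx.
have oldQ x : x \in cnbrs (v |: P) -> x \in U = false.
  by case/bigcupP=> w Qw; apply: oldU.
split=> [w|x y /newE[Ux|Qx] /newE[Uy|Qy] xy].
- rewrite setUCA => /setU1P[->|Qw] x y; last first.
    move=> wx wy; rewrite !(oldU w) //; exact: (cI w).
  have cN z : z \in cnbr u -> z \notin U -> z \in cnbr v.
    rewrite in_cnbr => /predU1P[-> _|uz]; first by rewrite in_cnbr vu orbT.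
    by rewrite inE in_nbr uz andbT negbK.
  have fN z t : z \in U -> t \in cnbr u -> t \notin U -> f z <> c t.
    move=> Uz ut Ut e; have /andP[] := fC z Uz; rewrite e inE imset_f //.
    by rewrite inE ut cN.
  move=> ux uy; case: ifPn => Ux; case: ifPn => Uy.
  + exact: fI.
  + by move/(fN x y Ux uy Uy).
  + by move/esym/(fN y x Uy ux Ux).
  + by apply: cIv; apply: cN.
- rewrite Ux Uy => /(fI x y Ux Uy) e; by rewrite e sedge_irr in xy.
- by rewrite Ux oldQ //; apply: nbad.
- by rewrite Uy oldQ // => /esym; apply: nbad; rewrite // sedge_sym.
- by rewrite !oldQ //; apply: cP.
Qed.

(** Induction on [#|P|]: when [u] is added last, at most [#|P| - 1] earlier vertices count against
    it, which explains the [+ 2]. *)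
Lemma rainbow_exists d (G : sgraph) (v : G) (P : {set G}) :
  regular d G -> C4_free G -> P \subset nbr v ->
  {in P, forall u, #|P|.*2 <= #|nbr u :\: cnbr v| + 2} ->
  exists c : G -> 'I_d.+1, rainbow (v |: P) c.
Proof.
move=> reg C4; have [n] := ubnP #|P|; elim: n P => // n IHn P le_n sPv leP.
have [->|[u Pu]] := set_0Vmem P.
  have [|c cI _] := @leq_injection G _ (ord0 : 'I_d.+1) (cnbr v) setT.
    by rewrite (card_cnbr _ reg) cardsT card_ord.
  have cnE : cnbrs (v |: set0) = cnbr v by rewrite /cnbrs setU0 big_set1.
  exists c; split=> [w|x y].
    by rewrite setU0 => /set1P ->.
  by rewrite cnE => vx vy xy /(cI _ _ vx vy) e; rewrite e sedge_irr in xy.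
have cPu := cardsD1 u P; rewrite Pu add1n in cPu.
have sPu : P :\ u \subset P by apply: subD1set.
have [|||c rc] := IHn (P :\ u).
- by rewrite -ltnS -cPu.
- exact: subset_trans sPu sPv.
- by move=> w /(subsetP sPu) /leP; rewrite cPu; lia.
rewrite -(setD1K Pu); apply: (@rainbow_add d G v u (P :\ u) c) => //.
- exact: subset_trans sPu sPv.
- by rewrite -in_nbr (subsetP sPv).
- by rewrite !inE eqxx.
- have := leP u Pu; have := subset_leq_card (subsetDl (P :\ u) (nbr u)).
  by rewrite cPu; lia.
Qed.

(** Besides [v], [nbr u :&: cnbr v] contains only common neighbours of [u] and [v], of which there
    is at most one. *)
Lemma leq_card_new_nbr d (G : sgraph) (v u : G) :
  regular d G -> C4_free G -> v -- u -> d <= #|nbr u :\: cnbr v| + 2.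
Proof.
move=> reg C4 vu; rewrite cardsD.
have -> : #|nbr u| = d by apply: reg.
suff : #|nbr u :&: cnbr v| <= 2 by lia.
rewrite setIUr (leq_trans (leq_card_setU _ _)) // (@leq_add _ _ 1 1) //.
  by rewrite (leq_trans (subset_leq_card (subsetIr _ _))) ?cards1.
apply/card_le1_eqP=> x y; rewrite !inE => /andP[ux vx] /andP[uy vy].
by apply: (C4 u v) => //; apply: contraTneq vu => ->; rewrite sedge_irr.
Qed.

(** * The two lower bounds *)

Lemma b_chromatic_triangle d (G : sgraph) :
  regular d G -> C4_free G -> contains_subgraph (cycle_graph 3) G ->
  (d + 4) %/ 2 <= b_chromatic G.
Proof.
move=> reg C4 [f _ fE]; pose i k (H : k < 3) : cycle_graph 3 := Ordinal H.
pose v := f (i 0 isT); pose a := f (i 1 isT); pose b := f (i 2 isT).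
have va : v -- a by apply: fE.
have vb : v -- b by apply: fE.
have ab : a -- b by apply: fE.
have anb : a != b by apply: contraTneq ab => ->; rewrite sedge_irr.
have cv : #|nbr v| = d by apply: reg.
have sab : [set a; b] \subset nbr v by rewrite subUset !sub1set !in_nbr va vb.
have d2 : 2 <= d by rewrite -cv (leq_trans _ (subset_leq_card sab)) // cards2 anb.
(* The size is one less than the bound, since [v] is a b-vertex too; both [a] and [b] are put into
   [P] so that [a] can be treated last. *)
have [|P [sabP sPv cP]] := subset_of_card (m := (d + 2) %/ 2) sab.
  by rewrite cards2 anb cv; lia.
have -> : (d + 4) %/ 2 = #|P|.+1 by rewrite cP; lia.
have Pa : a \in P by apply: (subsetP sabP); rewrite !inE eqxx.
have Pb : b \in P by apply: (subsetP sabP); rewrite !inE eqxx orbT.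
have cPa := cardsD1 a P; rewrite Pa add1n in cPa.
have le_d : (#|P :\ a|).*2 <= d by move: cPa; rewrite cP; move: #|_| => p; clear; lia.
have sPav : P :\ a \subset nbr v by apply: subset_trans (subD1set _ _) sPv.
have [|c rc] := @rainbow_exists d G v (P :\ a) reg C4 sPav.
  move=> u /(subsetP sPav); rewrite in_nbr => /(leq_card_new_nbr reg C4); exact: leq_trans.
have [||c' rc'] := @rainbow_add d G v a (P :\ a) c reg C4 sPav va _ _ rc.
- by rewrite !inE eqxx.
(* [b] is adjacent to [a] and drops out, so twice the count is at most [d - 2]. *)
- have : #|(P :\ a) :\: nbr a| < #|P :\ a|.
    apply/proper_card/properP; split; first exact: subsetDl.
    by exists b; rewrite !inE ?ab ?Pb ?andbT // eq_sym.
  move: (leq_card_new_nbr reg C4 va) le_d.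
  by do 3!move: #|_|; clear=> x y z; lia.
by rewrite setD1K // in rc'; apply: b_chromatic_rainbow reg sPv rc'.
Qed.

Lemma b_chromatic_C4_free d (G : sgraph) :
  0 < #|G| -> regular d G -> C4_free G -> (d + 3) %/ 2 <= b_chromatic G.
Proof.
move=> /card_gt0P[v _] reg C4.
have cv : #|nbr v| = d by apply: reg.
have [/existsP[a /existsP[b /and3P[va vb ab]]]|/existsPn noT] :=
    boolP [exists a : G, exists b : G, [&& v -- a, v -- b & a -- b]].
  apply: (@leq_trans ((d + 4) %/ 2)); first by lia.
  apply: b_chromatic_triangle => //.
  exists (tnth [tuple v; a; b] : cycle_graph 3 -> G).
    apply/tuple_uniqP => /=; rewrite !inE !negb_or !andbT.
    by do ?[apply/andP; split]; apply/eqP=> e; move: va vb ab; subst;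
       rewrite ?sedge_irr.
  move=> i j; rewrite !(tnth_nth v) /= /cycle_rel /= -!val_eqE /=.
  by case: i j => [[|[|[|]]]] //= _ [[|[|[|]]]] //= _; rewrite // sedge_sym.
(* Without triangles [nbr u] meets [cnbr v] only in [v]; the [d - 1] new vertices allow [#|P|.*2] up
   to [d + 1]. *)
have [|P [_ sPv cP]] := subset_of_card (m := (d + 1) %/ 2) (sub0set (nbr v)).
  by rewrite cards0 cv; lia.
have -> : (d + 3) %/ 2 = #|P|.+1 by rewrite cP; lia.
have [|c rc] := @rainbow_exists d G v P reg C4 sPv; last first.
  exact: b_chromatic_rainbow reg sPv rc.
move=> u /(subsetP sPv); rewrite in_nbr => vu.
suff : #|nbr u :&: cnbr v| <= 1.
  have : #|nbr u| = d by apply: reg.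
  by rewrite cardsD cP; lia.
apply: leq_trans (subset_leq_card (B := [set v]) _) _; last by rewrite cards1.
apply/subsetP=> x; rewrite !inE => /andP[ux /orP[//|vx]].
by have /existsPn/(_ x) := noT u; rewrite vu vx ux.
Qed.

(** * Regularity and 4-cycles of the Petersen graph *)

(** The neighbours of [A] are the 2-subsets of its three-element complement. *)
Lemma petersen_regular : regular 3 petersen.
Proof.
move=> A; have cA : #|~: val A| = 3 by rewrite cardsCs setCK (eqP (valP A)) card_ord.
have <- : #|[set B : {set 'I_5} | (B \subset ~: val A) && (#|B| == 2)]| = 3.
  by rewrite cards_draws cA.
rewrite -(card_imset _ val_inj); apply: eq_card => B; rewrite [RHS]inE.
apply/imsetP/andP=> [[C + ->]|[sBA cB]].
  by rewrite inE /= /petersen_rel disjoint_sym disjoints_subset (valP C).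
exists (Sub B cB : petersen) => //.
by rewrite inE /= /petersen_rel disjoint_sym disjoints_subset.
Qed.

(** Two distinct 2-subsets cover at least three points, so a common neighbour must be the whole
    complement of their union. *)
Lemma petersen_C4_free : C4_free petersen.
Proof.
move=> A B C D AB AC AD BC BD; apply: val_inj.
have sub (E : petersen) : A -- E -> B -- E -> val E = ~: (val A :|: val B).
  rewrite /= /petersen_rel => AE BE; apply/eqP; rewrite eqEcard setCU subsetI.
  rewrite -!disjoints_subset ![[disjoint val E & _]]disjoint_sym AE BE /=.
  rewrite -setCU cardsCs setCK card_ord (eqP (valP E)) leq_subLR.
  have : #|val A| < #|val A :|: val B|.
    rewrite ltn_neqAle subset_leq_card ?subsetUl // andbT.
    apply: contraNneq AB => cAU; rewrite -val_eqE eq_sym eqEcard.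
    rewrite (eqP (valP A)) (eqP (valP B)) andbT.
    have /eqP -> : val A == val A :|: val B by rewrite eqEcard subsetUl -cAU leqnn.
    exact: subsetUr.
  by rewrite (eqP (valP A)) -[X in _ -> X <= _]/(3 + 2) leq_add2r.
by rewrite (sub C) // (sub D).
Qed.

(** * Upper bound for the Petersen graph *)

(** A vertex, its three neighbours, then the other six, so that the search can prune early; each
    pair has its smaller element first. *)
Definition petersen_pairs : seq (nat * nat) :=
  [:: (0, 1); (2, 3); (2, 4); (3, 4); (0, 2); (1, 3); (1, 4); (0, 3); (1, 2); (0, 4)].

(** Adjacency lists by position in [petersen_pairs]; [petersen_set_disjoint] verifies them. *)
Definition petersen_nbrs (i : nat) : seq nat :=
  nth [::] [:: [:: 1; 2; 3]; [:: 0; 6; 9]; [:: 0; 5; 7]; [:: 0; 4; 8]; [:: 3; 5; 6];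
               [:: 2; 4; 9]; [:: 1; 4; 7]; [:: 2; 6; 8]; [:: 3; 7; 9]; [:: 1; 5; 8]] i.

Definition b_vertex_seq (s : seq nat) (i : nat) : bool :=
  all (fun j => (j == nth 0 s i) || has (fun k => nth 0 s k == j) (petersen_nbrs i))
      (iota 0 4).

Definition b_coloring_seq (s : seq nat) : bool :=
  all (fun j => has (fun i => if nth 0 s i == j then b_vertex_seq s i else false) (iota 0 10))
      (iota 0 4).

(** The next vertex has index [size s]; neighbours from that index on are still uncoloured. *)
Definition fresh_color (s : seq nat) (x : nat) : bool :=
  all (fun i => (size s <= i) || (nth 0 s i != x)) (petersen_nbrs (size s)).

(* Searches the proper extensions of s, the colours of the first vertices, by n
   more vertices. The if (not ==>) keeps vm_compute from exploring pruned branches. *)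
Fixpoint no_b_coloring (n : nat) (s : seq nat) : bool :=
  if n is n'.+1 then
    all (fun x => if fresh_color s x then no_b_coloring n' (rcons s x) else true) (iota 0 4)
  else ~~ b_coloring_seq s.

(** The induction follows the one branch of the search that [f] takes; it is never pruned because
    [f] is proper. *)
Lemma no_b_coloring_sound (n : nat) (f : nat -> nat) (m : nat) :
  no_b_coloring n (mkseq f m) -> (forall i, f i < 4) ->
  (forall i j, i < j < m + n -> i \in petersen_nbrs j -> f i != f j) ->
  ~~ b_coloring_seq (mkseq f (m + n)).
Proof.
move=> nb f4; elim: n m nb => [|n IHn] m nb prop; first by rewrite addn0.
rewrite addnS -addSn; apply: IHn => [|i j]; last by rewrite addSnnS; apply: prop.
have /allP/(_ (f m)) : all (fun x => if fresh_color (mkseq f m) x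
    then no_b_coloring n (rcons (mkseq f m) x) else true) (iota 0 4) := nb.
rewrite mem_iota f4 -mkseqS => /(_ isT); rewrite ifT //; apply/allP=> i; rewrite size_mkseq => im.
case: (leqP m i) => //= lt_im; rewrite nth_mkseq //; apply: prop im.
by rewrite lt_im addnS ltnS leq_addr.
Qed.

Lemma no_b_coloring_petersen : no_b_coloring 10 [::].
Proof. by vm_compute. Qed.

Definition petersen_set (i : nat) : {set 'I_5} :=
  let p := nth (0, 0) petersen_pairs i in [set inord p.1; inord p.2].

Lemma card_petersen_set i : i < 10 -> #|petersen_set i| == 2.
Proof.
by do 10?[case: i => [|i] //]; rewrite cards2 -val_eqE /= !inordK.
Qed.

(** Disjointness becomes a statement about equalities of numbers below 5, checked by computation for
    all pairs of indices. *)
Lemma petersen_set_disjoint i j : i < 10 -> j < 10 ->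
  [disjoint petersen_set i & petersen_set j] = (j \in petersen_nbrs i).
Proof.
pose p k := nth (0, 0) petersen_pairs k.
have eq5 a b : a < 5 -> b < 5 -> (inord a == inord b :> 'I_5) = (a == b).
  by move=> a5 b5; rewrite -val_eqE /= !inordK.
have p5 k : k < 10 -> (p k).1 < 5 /\ (p k).2 < 5.
  move=> k10; have /allP/(_ k) : all (fun k => ((p k).1 < 5) && ((p k).2 < 5)) (iota 0 10).
    by [].
  by rewrite mem_iota => /(_ k10)/andP.
move=> i10 j10; have [[i1 i2] [j1 j2]] := (p5 i i10, p5 j j10).
rewrite disjoints_subset subUset !sub1set !inE !eq5 //.
have /allP/(_ i) : all (fun i => all (fun j =>
    ~~ (((p i).1 == (p j).1) || ((p i).1 == (p j).2)) &&
    ~~ (((p i).2 == (p j).1) || ((p i).2 == (p j).2)) == (j \in petersen_nbrs i))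
    (iota 0 10)) (iota 0 10) by [].
by rewrite mem_iota => /(_ i10)/allP/(_ j); rewrite mem_iota => /(_ j10)/eqP.
Qed.

Lemma petersen_set_surj (A : {set 'I_5}) : #|A| == 2 ->
  exists2 i, i < 10 & A = petersen_set i.
Proof.
case/cards2P=> a [b [ab ->]]; move: ab.
wlog ab : a b / a < b.
  move=> IH ab; have [lt|lt|e] := ltngtP a b; first exact: IH.
    by rewrite setUC; apply: IH; rewrite // eq_sym.
  by case/eqP: ab; apply: val_inj.
move=> _.
pose i := index (val a, val b) petersen_pairs.
have mem : (val a, val b) \in petersen_pairs.
  by case: a b ab {i} => [[|[|[|[|[|]]]]]] //= _ [[|[|[|[|[|]]]]]].
exists i; first by rewrite -[10]/(size petersen_pairs) index_mem.
by rewrite /petersen_set nth_index //= !inord_val.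
Qed.

Lemma petersen_not_4_b_colorable : ~~ b_colorable petersen 4.
Proof.
apply/existsPn=> c; apply/negP=> /andP[/forallP prop /forallP cb].
have [v0 _] := existsP (cb ord0).
(* The default [v0] is returned only for [i >= 10]. *)
pose vx i : petersen := insubd v0 (petersen_set i).
have vxE i : i < 10 -> val (vx i) = petersen_set i.
  by move=> /card_petersen_set ci; rewrite insubdK.
have vx_edge i j : i < 10 -> j < 10 -> vx i -- vx j = (j \in petersen_nbrs i).
  by move=> i10 j10; rewrite /= /petersen_rel !vxE // petersen_set_disjoint.
have vx_surj v : exists2 i, i < 10 & v = vx i.
  have [i i10 vE] := petersen_set_surj (valP v).
  by exists i => //; apply: val_inj; rewrite vxE.
pose f i : nat := c (vx i).
have : ~~ b_coloring_seq (mkseq f (0 + 10)).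
  apply: (@no_b_coloring_sound 10 f 0) => [|i|i j /andP[ij j10]].
  - exact: no_b_coloring_petersen.
  - exact: ltn_ord.
  rewrite -vx_edge // 1?(ltn_trans ij) // => e.
  by have /forallP/(_ (vx i)) := prop (vx j); rewrite e eq_sym.
case/negP; apply/allP=> j; rewrite mem_iota => j4.
have /existsP[v /andP[/eqP cv /forallP bv]] := cb (Ordinal j4).
have [i i10 vE] := vx_surj v; subst v.
apply/hasP; exists i; first by rewrite mem_iota.
rewrite nth_mkseq // /f cv eqxx; apply/allP=> k; rewrite mem_iota => k4.
rewrite nth_mkseq // /f cv.
have [//|kj] := eqVneq k j.
have := bv (Ordinal k4); rewrite cv -val_eqE kj /= => /existsP[w /andP[iw /eqP cw]].
have [l l10 wE] := vx_surj w; subst w.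
by apply/hasP; exists l; rewrite -?vx_edge ?nth_mkseq // /f cw.
Qed.

(** A b-vertex and its [d] neighbours together show all [k] colours. *)
Lemma b_colorable_leq_degree d (G : sgraph) k :
  regular d G -> b_colorable G k -> k <= d.+1.
Proof.
move=> reg /existsP[c /andP[_ /forallP cb]]; case: k c cb => // k c cb.
have /existsP[v /andP[_ /forallP bv]] := cb ord0.
rewrite -[k.+1]card_ord -(card_cnbr v reg) -cardsT.
apply: leq_trans (leq_imset_card c _); apply/subset_leq_card/subsetP=> j _.
have [->|jv] := eqVneq j (c v); first by rewrite imset_f ?setU11.
have := bv j; rewrite jv => /existsP[w /andP[vw /eqP <-]].
by rewrite imset_f // in_cnbr vw orbT.
Qed.

Theorem theorem1 :
  (forall (d : nat) (G : sgraph),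
     0 < #|G| ->
     regular d G ->
     ~ contains_subgraph (cycle_graph 4) G ->
     (d + 3) %/ 2 <= b_chromatic G /\
     (contains_subgraph (cycle_graph 3) G -> (d + 4) %/ 2 <= b_chromatic G)) /\
  [/\ regular 3 petersen,
      ~ contains_subgraph (cycle_graph 4) petersen,
      b_chromatic petersen = 3,
      3 = (3 + 3) %/ 2 &
      3 = (3 + 4) %/ 2].
Proof.
split=> [d G G0 reg /C4_freeP C4|].
  by split; [apply: b_chromatic_C4_free | apply: b_chromatic_triangle].
split=> //; first exact: petersen_regular.
  by apply/C4_freeP; apply: petersen_C4_free.
apply/eqP; rewrite eqn_leq; apply/andP; split; last first.
  apply: (@b_chromatic_C4_free 3) petersen_regular petersen_C4_free.
  have [v] : exists v : petersen, true.
    by exists (Sub (petersen_set 0) (card_petersen_set (isT : 0 < 10))).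
  by move=> _; apply/card_gt0P; exists v.
(* Above 3 the degree bound leaves only [k = 4], which the exhaustive search excludes. *)
apply/bigmax_leqP=> k ck; rewrite leqNgt; apply/negP=> k3.
have := b_colorable_leq_degree petersen_regular ck.
rewrite leq_eqVlt ltnNge k3 orbF => /eqP k4.
by have := petersen_not_4_b_colorable; rewrite -k4 ck.
Qed.
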